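(* Let $(\mathbf x_k,\mathbf z_k,\boldsymbol\lambda_k)_{k\ge 0}$, $\boldsymbol\lambda_k=[\boldsymbol\alpha_k;\boldsymbol\beta_k]$, be generated by the DQM recursion (see context) with constant $c>0$. Assume the initialization satisfies $\boldsymbol\alpha_0=-\boldsymbol\beta_0$, $\mathbf E_u\mathbf x_0=2\mathbf z_0$, and $\boldsymbol\alpha_0$ lies in the column space of $\mathbf E_o$. Define $\boldsymbol\phi_k:=\mathbf E_o^T\boldsymbol\alpha_k$, the unoriented Laplacian $\mathbf L_u:=\frac12\mathbf E_u^T\mathbf E_u$, the oriented Laplacian $\mathbf L_o:=\frac12\mathbf E_o^T\mathbf E_o$, and the degree matrix $\mathbf D:=(\mathbf L_u+\mathbf L_o)/2$. Then the DQM iterates $\mathbf x_k$ can be generated by the recursion: for all $k\ge 0$, $$\mathbf x_{k+1}=(2c\mathbf D+\mathbf H_k)^{-1}\big[(c\mathbf L_u+\mathbf H_k)\mathbf x_k-\nabla f(\mathbf x_k)-\boldsymbol\phi_k\big],\qquad \boldsymbol\phi_{k+1}=\boldsymbol\phi_k+c\mathbf L_o\mathbf x_{k+1}.$$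
   Context: Network and matrices. Consider a connected network with node set $\mathcal V=\{1,\dots,n\}$ and a set $\mathcal E$ of $r$ ordered edges $(i,j)$, symmetric in the sense that $(i,j)\in\mathcal E$ iff $(j,i)\in\mathcal E$. The block source matrix $\mathbf A_s\in\mathbb R^{rp\times np}$ consists of $r\times n$ blocks of size $p\times p$, indexed by edges $e$ and nodes $i$: $(\mathbf A_s)_{e,i}=\mathbf I_p$ if $e=(i,j)\in\mathcal E$ for some $j$, and $\mathbf 0$ otherwise. The block destination matrix $\mathbf A_d\in\mathbb R^{rp\times np}$ has $(\mathbf A_d)_{e,i}=\mathbf I_p$ if $e=(j,i)\in\mathcal E$ for some $j$, and $\mathbf 0$ otherwise. Set $\mathbf A=[\mathbf A_s;\mathbf A_d]\in\mathbb R^{2rp\times np}$ and $\mathbf B=[-\mathbf I_{rp};-\mathbf I_{rp}]\in\mathbb R^{2rp\times rp}$ (semicolons denote vertical stacking), $\mathbf E_o=\mathbf A_s-\mathbf A_d$ (oriented incidence matrix), $\mathbf E_u=\mathbf A_s+\mathbf A_d$ (unoriented incidence matrix). Objective. $f_i:\mathbb R^p\to\mathbb R$ are local costs, assumed throughout to be twice differentiable and strongly convex; for $\mathbf x=[\mathbf x_1;\dots;\mathbf x_n]\in\mathbb R^{np}$, $f(\mathbf x)=\sum_{i=1}^n f_i(\mathbf x_i)$. DQM recursion with constant $c>0$: with $\mathbf H_k=\nabla^2 f(\mathbf x_k)$, $\mathbf z_k\in\mathbb R^{rp}$ and $\boldsymbol\lambda_k=[\boldsymbol\alpha_k;\boldsymbol\beta_k]$,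 $\boldsymbol\alpha_k,\boldsymbol\beta_k\in\mathbb R^{rp}$, for all $k\ge 0$ the iterates $\mathbf x_{k+1},\mathbf z_{k+1},\boldsymbol\lambda_{k+1}$ are determined by $$\nabla f(\mathbf x_k)+\mathbf H_k(\mathbf x_{k+1}-\mathbf x_k)+\mathbf A^T\boldsymbol\lambda_k+c\mathbf A^T(\mathbf A\mathbf x_{k+1}+\mathbf B\mathbf z_k)=\mathbf 0,$$ $$\mathbf B^T\boldsymbol\lambda_k+c\mathbf B^T(\mathbf A\mathbf x_{k+1}+\mathbf B\mathbf z_{k+1})=\mathbf 0,\qquad \boldsymbol\lambda_{k+1}-\boldsymbol\lambda_k-c(\mathbf A\mathbf x_{k+1}+\mathbf B\mathbf z_{k+1})=\mathbf 0.$$ *)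

(* Defs.v *)
From HB Require Import structures.
From mathcomp Require Import all_boot all_order all_algebra.
From mathcomp Require Import all_classical all_reals all_analysis.

Set Implicit Arguments.
Unset Strict Implicit.
Unset Printing Implicit Defensive.

Import Order.TTheory GRing.Theory Num.Theory.
Import numFieldNormedType.Exports.

Local Open Scope ring_scope.

Definition gradient (R : realType) (N : nat) (f : 'cV[R]_N -> R)
    (x : 'cV[R]_N) : 'cV[R]_N :=
  \col_(i < N) 'D_(delta_mx i 0) f x.

Definition hessian (R : realType) (N : nat) (f : 'cV[R]_N -> R)
    (x : 'cV[R]_N) : 'M[R]_N :=
  \matrix_(i < N, j < N)
    'D_(delta_mx j 0) (fun y : 'cV[R]_N => gradient f y i 0) x.

Definition twice_differentiable (R : realType) (N : nat)
    (f : 'cV[R]_N -> R) : Prop :=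
  (forall x : 'cV[R]_N, differentiable f x) /\
  (forall x : 'cV[R]_N, differentiable (gradient f) x).

(* The library norm `|x| on 'cV[R]_N is the sup norm, so the squared Euclidean
   norm is spelled out. *)
Definition sqnorm2 (R : realType) (N : nat) (x : 'cV[R]_N) : R :=
  \sum_(i < N) x i 0 ^+ 2.

Definition strongly_convex (R : realType) (N : nat)
    (f : 'cV[R]_N -> R) : Prop :=
  exists2 m : R, 0 < m &
    forall (x y : 'cV[R]_N) (t : R), 0 <= t <= 1 ->
      f (t *: x + (1 - t) *: y) <=
        t * f x + (1 - t) * f y - m / 2 * t * (1 - t) * sqnorm2 (x - y).

(* A network with nodes 'I_n and r ordered edges is given by a repetition-free
   enumeration of its edge set: (edge e).1 is the source of the e-th edge and
   (edge e).2 its destination. *)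
Record connected_network (n r : nat) (edge : 'I_r -> 'I_n * 'I_n) : Prop := {
  network_uniq : injective edge;
  network_sym : forall i j : 'I_n,
    ((i, j) \in codom edge) = ((j, i) \in codom edge);
  network_connected : forall i j : 'I_n,
    connect (fun u v : 'I_n => (u, v) \in codom edge) i j
}.

(* Stacked vectors and block matrices with m blocks of size p have dimension
   \sum_(i < m) p, the index type of MathComp's uniform block matrices; it plays
   the role of m * p. *)
Notation blk m p := (\sum_(i < m) p)%N (only parsing).

Section BlockMatrices.
Context (R : realType) (p : nat) {n r : nat} (edge : 'I_r -> 'I_n * 'I_n).

Definition source_mx : 'M[R]_(blk r p, blk n p) :=
  \mxblock_(e < r, i < n) (if (edge e).1 == i then 1%:M else 0 : 'M[R]_p).

Definition dest_mx : 'M[R]_(blk r p, blk n p) :=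
  \mxblock_(e < r, i < n) (if (edge e).2 == i then 1%:M else 0 : 'M[R]_p).

Definition A_mx : 'M[R]_(blk r p + blk r p, blk n p) :=
  col_mx source_mx dest_mx.

Definition B_mx : 'M[R]_(blk r p + blk r p, blk r p) :=
  col_mx (- 1%:M) (- 1%:M).

Definition oriented_incidence : 'M[R]_(blk r p, blk n p) :=
  source_mx - dest_mx.

Definition unoriented_incidence : 'M[R]_(blk r p, blk n p) :=
  source_mx + dest_mx.

Definition unoriented_laplacian : 'M[R]_(blk n p) :=
  2^-1 *: (unoriented_incidence^T *m unoriented_incidence).

Definition oriented_laplacian : 'M[R]_(blk n p) :=
  2^-1 *: (oriented_incidence^T *m oriented_incidence).

Definition degree_mx : 'M[R]_(blk n p) :=
  2^-1 *: (unoriented_laplacian + oriented_laplacian).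

End BlockMatrices.

Definition aggregate (R : realType) (n p : nat)
    (f : 'I_n -> 'cV[R]_p -> R) (x : 'cV[R]_(blk n p)) : R :=
  \sum_(i < n) f i (submxcol x i).

Definition dqm_iterates (R : realType) (n r p : nat)
    (edge : 'I_r -> 'I_n * 'I_n) (f : 'I_n -> 'cV[R]_p -> R) (c : R)
    (x : nat -> 'cV[R]_(blk n p)) (z : nat -> 'cV[R]_(blk r p))
    (lambda : nat -> 'cV[R]_(blk r p + blk r p)) : Prop :=
  let A := A_mx R p edge in
  let B := B_mx R p in
  let F := aggregate f in
  forall k : nat,
    [/\ gradient F (x k) + hessian F (x k) *m (x k.+1 - x k)
          + A^T *m lambda k + c *: (A^T *m (A *m x k.+1 + B *m z k)) = 0,
        B^T *m lambda k + c *: (B^T *m (A *m x k.+1 + B *m z k.+1)) = 0 &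
        lambda k.+1 - lambda k - c *: (A *m x k.+1 + B *m z k.+1) = 0].

(* Main.v *)
(* The z- and multiplier updates force alpha_k + beta_k = 0 from the first step
   on; with the initialization this makes E_u x_k = 2 z_k an invariant, so z and
   beta can be eliminated: A^T A = 2 D, A^T B z_k = - L_u x_k and
   A^T lambda_k = phi_k.  The x-update is then a linear system with matrix
   2 c D + H_k, and it remains to invert this matrix.  D is positive
   semidefinite; strong convexity gives the gradient monotonicity
   <grad f (x + t v) - grad f x, t v> >= m t^2 |v|^2, and dividing by t^2 and
   letting t -> 0 yields v^T H_k v >= m |v|^2. *)
Require Import Defs.
From HB Require Import structures.
From mathcomp Require Import all_boot all_order all_algebra.
From mathcomp Require Import all_classical all_reals all_analysis.
From mathcomp Require Import lra.

Set Implicit Arguments.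
Unset Strict Implicit.
Unset Printing Implicit Defensive.

Import Order.TTheory GRing.Theory Num.Theory.
Import numFieldNormedType.Exports.

Local Open Scope ring_scope.
Local Open Scope classical_set_scope.

(** * Directional derivatives and the squared Euclidean norm *)

Lemma derive_gradient (R : realType) (N : nat) (f : 'cV[R]_N -> R)
    (x v : 'cV[R]_N) :
  differentiable f x -> 'D_v f x = \sum_(i < N) v i 0 * gradient f x i 0.
Proof.
move=> df; rewrite deriveE// {1}(matrix_sum_delta v) linear_sum/=.
apply: eq_bigr => i _; rewrite big_ord1 linearZ/= mxE deriveE//.
Qed.

(** For small [t > 0] the difference quotient is at most [a + t * b], and the bound passes to the
    limit from the right. Strong convexity enters the derivative estimates through this lemma. *)
Lemma derive_le (R : realType) (V : normedModType R) (f : V -> R) (x v : V)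
    (a b : R) :
  derivable f x v ->
  (forall t, 0 < t < 1 -> f (t *: v + x) - f x <= t * (a + t * b)) ->
  'D_v f x <= a.
Proof.
move=> dfx fle; set q := fun h : R => h^-1 *: (f (h *: v + x) - f x).
have qD : q h @[h --> 0^'+] --> 'D_v f x.
  by apply: cvg_dnbhs_at_right; exact: dfx.
have ha : a + h * b @[h --> 0^'+] --> a.
  rewrite -[X in _ --> X]addr0 -[X in _ --> _ + X](mul0r b).
  apply: cvgD; first exact: cvg_cst.
  by apply: cvgMl; apply: cvg_within_filter; exact: cvg_id.
apply: (ler_cvg_to qD ha); near=> h.
have h0 : 0 < h by near: h; exact: nbhs_right_gt.
rewrite /q /= ler_pdivrMl//; apply: fle; rewrite h0 /=.
by near: h; exact: nbhs_right_lt.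
Unshelve. all: by end_near. Qed.

Lemma sqnorm2Z (R : realType) (N : nat) (t : R) (v : 'cV[R]_N) :
  sqnorm2 (t *: v) = t ^+ 2 * sqnorm2 v.
Proof.
by rewrite /sqnorm2 mulr_sumr; apply: eq_bigr => i _; rewrite mxE exprMn.
Qed.

Lemma sqnorm2_ge0 (R : realType) (N : nat) (v : 'cV[R]_N) : 0 <= sqnorm2 v.
Proof. by apply: sumr_ge0 => i _; exact: sqr_ge0. Qed.

Lemma sqnorm2_le0 (R : realType) (N : nat) (v : 'cV[R]_N) :
  sqnorm2 v <= 0 -> v = 0.
Proof.
move=> v0; have /eqP : sqnorm2 v = 0 by apply/le_anti; rewrite v0 sqnorm2_ge0.
rewrite psumr_eq0 => [/allP v_eq0|i _]; last exact: sqr_ge0.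
apply/matrixP => i j; rewrite ord1 mxE; apply/eqP.
by have := v_eq0 i; rewrite mem_index_enum sqrf_eq0 => /(_ isT).
Qed.

Lemma sqnorm2_mulmx (R : realType) (N : nat) (v : 'cV[R]_N) :
  (v^T *m v) 0 0 = sqnorm2 v.
Proof.
by rewrite mxE; apply: eq_bigr => i _; rewrite mxE expr2.
Qed.

(** * From strong convexity to a lower bound on the Hessian *)

Section StronglyConvex.
Variables (R : realType) (N : nat) (f : 'cV[R]_N -> R) (m : R).
Hypothesis fconv : forall (x y : 'cV[R]_N) (t : R), 0 <= t <= 1 ->
  f (t *: x + (1 - t) *: y) <=
    t * f x + (1 - t) * f y - m / 2 * t * (1 - t) * sqnorm2 (x - y).
Hypothesis fdiff : forall x, differentiable f x.

Lemma derive_le_sub (x v : 'cV[R]_N) :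
  'D_v f x <= f (v + x) - f x - m / 2 * sqnorm2 v.
Proof.
(* The point [t *: v + x] is the convex combination of [v + x] and [x] with weight [t]; this [b]
   collects the [t ^+ 2] term of the convexity bound. *)
apply: (@derive_le _ _ _ _ _ _ (m / 2 * sqnorm2 v)).
  exact: diff_derivable.
move=> t /andP[t0 t1].
have t01 : 0 <= t <= 1 by rewrite !ltW.
have := fconv (v + x) x t01.
rewrite addrK scalerDr -addrA -scalerDl subrKC scale1r; lra.
Qed.

(** Adding the first-order bounds at [x] along [v] and at [v + x] along [- v] cancels the values of
    [f]. *)
Lemma derive_monotone (x v : 'cV[R]_N) :
  m * sqnorm2 v <= 'D_v f (v + x) - 'D_v f x.
Proof.
have := derive_le_sub x v.
have := derive_le_sub (v + x) (- v).
rewrite addKr -[X in sqnorm2 X]scaleN1r sqnorm2Z sqrrN expr1n mul1r.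
have -> : 'D_(- v) f (v + x) = - 'D_v f (v + x).
  by rewrite (deriveE _ (fdiff _)) (deriveE _ (fdiff _)) raddfN.
lra.
Qed.

Hypothesis gdiff : forall (i : 'I_N) x,
  differentiable (fun y => gradient f y i 0) x.

Lemma hessian_ge (x v : 'cV[R]_N) :
  m * sqnorm2 v <= (v^T *m (hessian f x *m v)) 0 0.
Proof.
(* The quadratic form is the derivative along [v] of the map [y] to ['D_v f y], so a bound on the
   increments of that map suffices. *)
have hessE : (v^T *m (hessian f x *m v)) 0 0 =
    'D_v (\sum_i (v i 0 *: (fun y => gradient f y i 0))) x.
  rewrite derive_sum => [|i]; last exact/derivableZ/diff_derivable.
  rewrite mxE; apply: eq_bigr => i _; rewrite mxE deriveZ; last first.
    exact: diff_derivable.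
  rewrite derive_gradient// mxE; congr (_ * _).
  by apply: eq_bigr => j _; rewrite !mxE mulrC.
have DvE y : (\sum_i (v i 0 *: (fun y => gradient f y i 0))) y = 'D_v f y.
  by rewrite fct_sumE derive_gradient.
have dD : derivable (\sum_i (v i 0 *: (fun y => gradient f y i 0))) x v.
  by apply: derivable_sum => i; exact/derivableZ/diff_derivable.
(* [derive_le] gives upper bounds only, hence the change of sign. *)
rewrite hessE -lerN2 -deriveN//.
apply: (@derive_le _ _ _ _ _ _ 0); first exact: derivableN.
move=> t /andP[t0 _]; rewrite mulr0 addr0 !fctE !DvE.
have := derive_monotone x (t *: v).
have DZ y : 'D_(t *: v) f y = t * 'D_v f y.
  by rewrite (deriveE _ (fdiff _)) (deriveE _ (fdiff _)) linearZ.
rewrite sqnorm2Z !DZ -mulrBr.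
(* Monotonicity along [t *: v] carries [t ^+ 2] on the left and [t] on the right; one factor [t]
   cancels. *)
rewrite expr2 mulrCA -mulrA ler_pM2l// => le_tv.
lra.
Qed.

End StronglyConvex.

(** * Regularity and convexity of the separable sum *)

Section Aggregate.
Variables (R : realType) (n p : nat) (f : 'I_n -> 'cV[R]_p -> R).

Lemma differentiable_submxcol (i : 'I_n) (x : 'cV[R]_(blk n p)) :
  differentiable (fun y : 'cV[R]_(blk n p) => submxcol y i) x.
Proof.
pose g0 (y : 'cV[R]_(blk n p)) : 'cV[R]_p := submxcol y i.
have g0_linear : linear g0 by move=> a y z; apply/matrixP => j k; rewrite !mxE.
pose g0M := GRing.isLinear.Build _ _ _ _ _ g0_linear.
pose g : {linear 'cV[R]_(blk n p) -> 'cV[R]_p} := HB.pack g0 g0M.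
(* Continuity of the linear map remains: balls are entrywise and a block only selects entries, so
   the same radius works. *)
apply: (@linear_differentiable _ _ _ g) => y s /= /nbhs_ballP[e e0 es].
apply/nbhs_ballP; exists e => //= z [_ yz]; apply: es; split=> // j k.
by rewrite !mxE; exact: yz.
Qed.

Lemma sqnorm2_submxcol (v : 'cV[R]_(blk n p)) :
  sqnorm2 v = \sum_(i < n) sqnorm2 (submxcol v i).
Proof.
rewrite -sqnorm2_mulmx -{1 2}(submxcolK v) tr_mxcol mul_mxrow_mxcol summxE.
by apply: eq_bigr => i _; rewrite sqnorm2_mulmx.
Qed.

Hypothesis fdiff : forall i, twice_differentiable (f i).

Lemma differentiable_aggregate (x : 'cV[R]_(blk n p)) :
  differentiable (aggregate f) x.
Proof.
have -> : aggregate f = \sum_i (f i \o (fun y => submxcol y i)).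
  by apply/funext => y; rewrite fct_sumE.
apply: differentiable_sum => i; apply: differentiable_comp.
  exact: differentiable_submxcol.
by have [] := fdiff i.
Qed.

Lemma derive_submxcol (i : 'I_n) (g : 'cV[R]_p -> R) (x v : 'cV[R]_(blk n p)) :
  'D_v (fun y : 'cV[R]_(blk n p) => g (submxcol y i)) x
    = 'D_(submxcol v i) g (submxcol x i).
Proof.
rewrite /derive.
suff -> : (fun h => h^-1 *: (((fun y => g (submxcol y i)) \o shift x) (h *: v)
      - g (submxcol x i))) =
    (fun h => h^-1 *: ((g \o shift (submxcol x i)) (h *: submxcol v i)
      - g (submxcol x i))) by [].
apply/funext => h /=; congr (_ *: (g _ - _)).
by apply/matrixP => j k; rewrite !mxE.
Qed.

(** The coefficients do not depend on [x], so each entry of the gradient becomes a fixed linear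
    combination of local gradient entries; its differentiability follows from this form. *)
Lemma gradient_aggregate (x : 'cV[R]_(blk n p)) k :
  gradient (aggregate f) x k 0 =
    \sum_(i < n) \sum_(j < p)
      submxcol (delta_mx k 0 : 'cV[R]_(blk n p)) i j 0
        * gradient (f i) (submxcol x i) j 0.
Proof.
rewrite mxE.
have -> : aggregate f = \sum_i (fun y => f i (submxcol y i)).
  by apply/funext => y; rewrite fct_sumE.
rewrite derive_sum => [|i]; last first.
  apply: diff_derivable; apply: (@differentiable_comp _ _ _ _ _ (f i)).
    exact: differentiable_submxcol.
  by have [] := fdiff i.
apply: eq_bigr => i _; rewrite derive_submxcol derive_gradient//.
by have [] := fdiff i.
Qed.

Lemma differentiable_gradient_aggregate k (x : 'cV[R]_(blk n p)) :
  differentiable (fun y => gradient (aggregate f) y k 0) x.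
Proof.
have -> : (fun y => gradient (aggregate f) y k 0) =
    \sum_(i < n) \sum_(j < p)
      submxcol (delta_mx k 0 : 'cV[R]_(blk n p)) i j 0 *:
        ((fun u : 'cV[R]_p => u j 0) \o gradient (f i) \o
          (fun y => submxcol y i)).
  apply/funext => y; rewrite gradient_aggregate fct_sumE.
  by apply: eq_bigr => i _; rewrite fct_sumE.
apply: differentiable_sum => i; apply: differentiable_sum => j.
apply: differentiableZ.
apply: differentiable_comp; first exact: differentiable_submxcol.
apply: differentiable_comp; last exact: differentiable_coord.
by have [_] := fdiff i; apply.
Qed.

Lemma strongly_convex_aggregate :
  (forall i, strongly_convex (f i)) -> strongly_convex (aggregate f).
Proof.
move=> fconv.
have /choice[mu muP] : forall i, exists mu, 0 < mu /\
    forall (x y : 'cV[R]_p) (t : R), 0 <= t <= 1 ->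
      f i (t *: x + (1 - t) *: y) <=
        t * f i x + (1 - t) * f i y - mu / 2 * t * (1 - t) * sqnorm2 (x - y).
  by move=> i; have [mu mu0 fi] := fconv i; exists mu.
(* The least local modulus serves all blocks; the default [1] keeps it positive when [n] is zero. *)
exists (\big[Num.min/1]_(i < n) mu i).
  by apply: lt_bigmin => // i _; have [] := muP i.
move=> x y t t01; rewrite /aggregate sqnorm2_submxcol !mulr_sumr -big_split/=.
rewrite -sumrB; apply: ler_sum => i _; have [_ /(_ _ _ _ t01)] := muP i.
move=> /(_ (submxcol x i) (submxcol y i)) fi; rewrite submxcolD submxcolB.
have -> : submxcol (t *: x) i = t *: submxcol x i.
  by apply/matrixP => j k; rewrite !mxE.
have -> : submxcol ((1 - t) *: y) i = (1 - t) *: submxcol y i.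
  by apply/matrixP => j k; rewrite !mxE.
apply: le_trans fi _; rewrite lerB// -!mulrA.
apply: ler_wpM2r; last exact: bigmin_le.
case/andP: t01 => t0 t1.
by rewrite !mulr_ge0 ?subr_ge0 ?sqnorm2_ge0.
Qed.

End Aggregate.

(** A row vector [v] with [v *m M = 0] makes the quadratic form of [M] vanish at [v^T], so the left
    kernel is trivial. *)
Lemma unitmx_sub (K : fieldType) (N : nat) (M : 'M[K]_N) :
  (forall v : 'cV_N, (v^T *m (M *m v)) 0 0 = 0 -> v = 0) -> M \in unitmx.
Proof.
move=> Minj; rewrite -row_free_unit; apply: inj_row_free => v vM0.
apply: trmx_inj; rewrite trmx0; apply: Minj.
by rewrite trmxK mulmxA vM0 mul0mx mxE.
Qed.

(** * The degree matrix as a sum of two Gram matrices *)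

Section Incidence.
Variables (R : realType) (n r p : nat) (edge : 'I_r -> 'I_n * 'I_n).
Let As := source_mx R p edge.
Let Ad := dest_mx R p edge.

(** The mixed products of [As] and [Ad] have opposite signs in the two Laplacians and cancel. *)
Lemma degree_mxE :
  2 *: degree_mx R p edge = As^T *m As + Ad^T *m Ad.
Proof.
rewrite /degree_mx /unoriented_laplacian /oriented_laplacian.
rewrite /unoriented_incidence /oriented_incidence -/As -/Ad.
rewrite -scalerDr !scalerA mulfV ?pnatr_eq0// mul1r.
rewrite [(As + Ad)^T]linearD [(As - Ad)^T]linearB/=.
rewrite !mulmxBr !mulmxDr !mulmxBl !mulmxDl.
move: (As^T *m As) (As^T *m Ad) (Ad^T *m As) (Ad^T *m Ad) => SS SD DS DD.
apply/matrixP => i j; rewrite !mxE; lra.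
Qed.

Lemma degree_mx_ge0 (v : 'cV[R]_(blk n p)) :
  0 <= (v^T *m (2 *: degree_mx R p edge *m v)) 0 0.
Proof.
rewrite degree_mxE mulmxDl mulmxDr -!mulmxA !mulmxA -!trmx_mul -!mulmxA mxE.
by rewrite !sqnorm2_mulmx addr_ge0// sqnorm2_ge0.
Qed.

End Incidence.

Theorem proposition1 (R : realType) (n r p : nat)
    (edge : 'I_r -> 'I_n * 'I_n) (hnet : connected_network edge)
    (f : 'I_n -> 'cV[R]_p -> R)
    (hdiff : forall i : 'I_n, twice_differentiable (f i))
    (hconv : forall i : 'I_n, strongly_convex (f i))
    (c : R) (hc : 0 < c)
    (x : nat -> 'cV[R]_(blk n p)) (z alpha beta : nat -> 'cV[R]_(blk r p))
    (lambda : nat -> 'cV[R]_(blk r p + blk r p))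
    (hlambda : forall k : nat, lambda k = col_mx (alpha k) (beta k))
    (hdqm : dqm_iterates edge f c x z lambda)
    (halpha0 : alpha 0%N = - beta 0%N)
    (hz0 : unoriented_incidence R p edge *m x 0%N = 2 *: z 0%N)
    (hcol0 : exists w : 'cV[R]_(blk n p),
       alpha 0%N = oriented_incidence R p edge *m w)
    (phi : nat -> 'cV[R]_(blk n p))
    (hphi : forall k : nat, phi k = (oriented_incidence R p edge)^T *m alpha k) :
  let Lu := unoriented_laplacian R p edge in
  let Lo := oriented_laplacian R p edge in
  let D := degree_mx R p edge in
  let F := aggregate f in
  forall k : nat,
    let H := hessian F (x k) in
    [/\ (2 * c) *: D + H \in unitmx,
        x k.+1 = invmx ((2 * c) *: D + H)
                   *m ((c *: Lu + H) *m x k - gradient F (x k) - phi k) &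
        phi k.+1 = phi k + c *: (Lo *m x k.+1)].
Proof.
move=> Lu Lo D F k H.
pose As := source_mx R p edge; pose Ad := dest_mx R p edge.
(* Substituting the multiplier update into the [z]-update gives [B^T *m lambda j.+1 = 0], and [B^T]
   is minus the block sum. *)
have sumS j : alpha j.+1 + beta j.+1 = 0.
  have [_ h2 h3] := hdqm j.
  have : (B_mx R p)^T *m lambda j.+1 = 0 :> 'cV[R]_(blk r p).
    rewrite -h2 -[in LHS](subrK (lambda j) (lambda j.+1)).
    move/eqP: h3; rewrite subr_eq0 => /eqP ->.
    by rewrite [LHS]mulmxDr -scalemxAr addrC.
  rewrite hlambda tr_col_mx mul_row_col linearN/= trmx1 !mulNmx !mul1mx.
  by rewrite -opprD => /eqP; rewrite oppr_eq0 => /eqP.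
have sum0 j : alpha j + beta j = 0.
  by case: j => [|j //]; rewrite halpha0 addNr.
have multiplierS j : alpha j.+1 - alpha j = c *: (As *m x j.+1 - z j.+1) /\
    beta j.+1 - beta j = c *: (Ad *m x j.+1 - z j.+1).
  have [_ _ /eqP] := hdqm j.
  rewrite subr_eq0 !hlambda /A_mx /B_mx !mul_col_mx !mulNmx mul1mx add_col_mx.
  rewrite scale_col_mx opp_col_mx add_col_mx => /eqP/eq_col_mx[-> ->].
  by rewrite -/As -/Ad.
(* Index zero is the initialization. Afterwards the two multiplier increments sum to zero, and [c]
   is divided out. *)
have zE j : unoriented_incidence R p edge *m x j = 2 *: z j.
  case: j => [//|j]; have [ha hb] := multiplierS j.
  have /eqP : c *: (As *m x j.+1 + Ad *m x j.+1 - 2 *: z j.+1) = 0.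
    have <- : c *: (As *m x j.+1 - z j.+1) + c *: (Ad *m x j.+1 - z j.+1)
        = c *: (As *m x j.+1 + Ad *m x j.+1 - 2 *: z j.+1).
      by rewrite -scalerDr addrACA -opprD scaler_nat mulr2n.
    by rewrite -ha -hb addrACA -opprD !sum0 subr0.
  rewrite scaler_eq0 gt_eqF//= subr_eq0 => /eqP <-.
  by rewrite /unoriented_incidence mulmxDl.
(* Subtracting the two multiplier updates cancels [z]; since [beta] is [- alpha], the left side is
   twice the increment of [alpha], whence [c / 2]. *)
have alphaS j : alpha j.+1 =
    alpha j + (c / 2) *: (oriented_incidence R p edge *m x j.+1).
  have [ha hb] := multiplierS j.
  rewrite /oriented_incidence mulmxBl -/As -/Ad.
  apply/matrixP => a b.
  move/matrixP/(_ a b): ha; move/matrixP/(_ a b): hb.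
  move/matrixP/(_ a b): (sum0 j); move/matrixP/(_ a b): (sum0 j.+1).
  rewrite ![fun_of_matrix (_ + _) _ _]mxE ![fun_of_matrix (- _) _ _]mxE.
  rewrite ![fun_of_matrix (_ *: _) _ _]mxE.
  rewrite ![fun_of_matrix (_ + _) _ _]mxE ![fun_of_matrix (- _) _ _]mxE.
  rewrite mxE; lra.
(* If the form vanishes at [v], the Hessian term equals minus a nonnegative degree term, so
   [m * sqnorm2 v <= 0]. *)
have unitDH : (2 * c) *: D + H \in unitmx.
  have [m m0 Fm] := strongly_convex_aggregate hconv.
  apply: unitmx_sub => v vDHv; apply: sqnorm2_le0.
  rewrite -(pmulr_rle0 _ m0); apply: le_trans (hessian_ge Fm _ _ (x k) v) _.
  - exact: differentiable_aggregate.
  - exact: differentiable_gradient_aggregate.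
  - move: vDHv; rewrite mulmxDl mulmxDr mxE -/H mulrC -scalerA -scalemxAl.
    rewrite -scalemxAr mxE => /eqP; rewrite addrC addr_eq0 => /eqP ->.
    by rewrite oppr_le0 mulr_ge0 ?degree_mx_ge0// ltW.
have phiE j : phi j = (A_mx R p edge)^T *m lambda j.
  rewrite hphi hlambda tr_col_mx mul_row_col -/As -/Ad.
  have -> : beta j = - alpha j by apply/eqP; rewrite -addr_eq0 addrC sum0.
  by rewrite /oriented_incidence linearB/= mulmxBl mulmxN.
split=> //.
(* Multiplying both sides by the invertible matrix reduces the claim to the linear system of the
   first DQM equation. *)
- apply: (can_inj (mulKmx unitDH)); rewrite mulKVmx//.
  have [h1 _ _] := hdqm k.
  have AA : (A_mx R p edge)^T *m A_mx R p edge = 2 *: D.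
    by rewrite /D degree_mxE /A_mx tr_col_mx mul_row_col.
  have AB : (A_mx R p edge)^T *m (B_mx R p *m z k) = - (Lu *m x k).
    rewrite /A_mx /B_mx tr_col_mx mulmxA mul_row_col !mulmxN !mulmx1.
    rewrite /Lu /unoriented_laplacian -scalemxAl -mulmxA zE -scalemxAr scalerA.
    rewrite mulVf ?pnatr_eq0// scale1r -opprD mulNmx.
    by rewrite /unoriented_incidence linearD.
  move: h1; rewrite -phiE -/F -/H mulmxDr mulmxA AA AB.
  rewrite [2 * c]mulrC -scalerA.
  move: (2 *: D) Lu (gradient F (x k)) {AA AB} => M L g; rewrite mulmxBr !mulmxDl.
  rewrite -!scalemxAl; move: (H *m _) (H *m _) (M *m _) (L *m _) => Hx' Hx Mx' Lx.
  (* The difference of the two sides is exactly the left side of the DQM equation, an entrywise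
     linear identity. *)
  move=> h1; apply/eqP; rewrite -subr_eq0 -{}h1; apply/eqP/matrixP => i j.
  rewrite !mxE; lra.
- rewrite !hphi alphaS mulmxDr -scalemxAr mulmxA -scalerA.
  by rewrite /Lo /oriented_laplacian -scalemxAl.
Qed.
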